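(* Let $\xi$, $\Lambda$, $B$, $\zeta$, $H$ and $\mathcal{G}$ satisfy the standing assumptions given in the context, let $G\in\mathcal{G}$, and put $\lambda_t=\mathrm{ess\,inf}\,\Lambda(t)$, $V_t(\lambda)=\mathbf{P}(\Lambda(t)<\lambda)$ and $\eta_t(u)=\xi(\Lambda(t)u)$, $u\in[0,1]$. Assume that $\lambda_t\sim\tilde\lambda_t$ as $t\to\infty$, where $\tilde\lambda_t$ is a continuous, strictly increasing function of $t$. Suppose that $\lambda_t\to\infty$ as $t\to\infty$ and that for every $c>1$ $$\liminf_{t\to\infty}V_t(c\lambda_t)>0.$$ Then $$\log\mathbf{P}\left(\eta_t(\cdot)\in G y_t\right)=-\lambda_t H(G)\zeta(y_t)(1+o(1))\quad\text{as } t\to\infty$$ for every positive function $y_t$ with $y_t\to\infty$, $y_t=o(B(\tilde\lambda_t))$ and $\lambda_t\zeta(y_t)\to\infty$ as $t\to\infty$.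
   Context: Standing assumptions. $\xi(t)$ and $\Lambda(t)$, $t\ge 0$, are independent real-valued stochastic processes on the same probability space. With probability 1, $\Lambda(t)$ has continuous trajectories, $\Lambda(t)\ge 0$ and $\Lambda(0)=0$; with probability 1, the trajectories of $\xi(t)$ are right continuous and $\xi(0)=0$. For $t\ge 0$ put $\xi_t(u)=\xi(tu)$, $u\in[0,1]$; trajectories of $\xi_t$ and of $\eta_t$ are regarded as elements of the Skorohod space $D[0,1]$. $\mathcal{G}$ is the collection of all sets $G=\{g\in D[0,1]: g(0)=0,\ -g_1(u)\le g(u)\le g_2(u)\text{ for all }u\in[0,1]\}$, where $g_1,g_2$ are positive, continuous, non-decreasing functions on $[0,1]$ (so $g_i(0)>0$). For real $a$, $aG=\{ag: g\in G\}$, and $Gy_t$ means $y_tG$. $B(t)$ and $\zeta(t)$, $t>0$, are positive functions and $H(G)$, $G\in\mathcal{G}$, is a positive functional such that $B(t)\to\infty$ and $\zeta(t)\to0$ as $t\to\infty$, $\limsup_{t\to\infty}B(ct)/B(t)<\infty$ for all $c>0$, and for every $G\in\mathcal{G}$ the relation $$\log\mathbf{P}\left(\xi_t(\cdot)\in Gy_t\right)=-tH(G)\zeta(y_t)(1+o(1))\quad\text{as }t\to\infty$$ holds for every positive function $y_t$ with $y_t\to\infty$, $y_t=o(B(t))$ and $t\zeta(y_t)\to\infty$ as $t\to\infty$. Notation: $a_t\sim b_t$ means $a_t/b_t\to1$ as $t\to\infty$; $\mathrm{ess\,inf}$ denotes the essential infimum of a random variable. *)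

(* Defs.v *)
From HB Require Import structures.
From mathcomp Require Import all_boot all_order all_algebra.
From mathcomp Require Import all_classical all_reals all_analysis ess_sup_inf.

Set Implicit Arguments.
Unset Strict Implicit.
Unset Printing Implicit Defensive.

Import Order.TTheory GRing.Theory Num.Theory.
Import numFieldNormedType.Exports.

Local Open Scope classical_set_scope.
Local Open Scope ring_scope.

(* A function on [0, 1] (or a process indexed by t >= 0) is represented by a
   total function on R whose values outside the domain are unconstrained. *)

Definition cadlag_halfline (R : realType) (f : R -> R) : Prop :=
  (forall t : R, 0 <= t -> f x @[x --> t^'+] --> f t) /\
  (forall t : R, 0 < t -> cvg (f x @[x --> t^'-])).

Definition skorohod01 (R : realType) : set (R -> R) :=
  [set f : R -> R | (forall u : R, 0 <= u < 1 -> f x @[x --> u^'+] --> f u) /\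
                    (forall u : R, 0 < u <= 1 -> cvg (f x @[x --> u^'-]))].

Definition corridor (R : realType) (g1 g2 : R -> R) : set (R -> R) :=
  [set g : R -> R | skorohod01 g /\ g 0 = 0 /\
           forall u : R, 0 <= u <= 1 -> - g1 u <= g u <= g2 u].

Definition corridor_boundary (R : realType) (g : R -> R) : Prop :=
  [/\ forall u : R, 0 <= u <= 1 -> 0 < g u,
      {within `[0, 1], continuous g} &
      {in `[0, 1] &, {homo g : u v / u <= v}}].

Definition corridors (R : realType) : set (set (R -> R)) :=
  [set G | exists g1 g2 : R -> R,
     [/\ corridor_boundary g1, corridor_boundary g2 & G = corridor g1 g2]].

Definition dilate (R : realType) (a : R) (G : set (R -> R)) : set (R -> R) :=
  [set (fun u => a * g u) | g in G].

Definition process_sigma d (T : measurableType d) (R : realType)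
    (X : R -> T -> R) : set (set T) :=
  <<s [set A | exists t : R, 0 <= t /\
                 exists B : set R, measurable B /\ A = X t @^-1` B] >>.

Definition independent_processes d (T : measurableType d) (R : realType)
    (P : probability T R) (X Y : R -> T -> R) : Prop :=
  forall A B, process_sigma X A -> process_sigma Y B ->
    P (A `&` B) = (P A * P B)%E.

(* Path properties hold only almost surely and the probability space need not
   be complete, so path events are measurable only for the completion of P.
   The outer measure of P extends that completion, hence coincides with P on
   every measurable event. *)
Definition Pr d (T : measurableType d) (R : realType) (P : probability T R)
    (A : set T) : \bar R := mu_ext P A.

(* [fine] is harmless for X >= 0 almost surely: the essential infimum of such
   a random variable lies in [0, +oo[. *)
Definition essinf d (T : measurableType d) (R : realType)
    (P : probability T R) (X : T -> R) : R :=
  fine (ess_inf P (EFin \o X)).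

(* log p_t = a_t (1 + o(1)) as t -> +oo; [lne 0 = -oo], so this forces p_t to
   be eventually positive. *)
Definition log_asymptotics (R : realType) (p : R -> \bar R) (a : R -> R)
    : Prop :=
  exists e : R -> R, e t @[t --> +oo] --> 0 /\
    \forall t \near +oo, lne (p t) = (a t * (1 + e t))%:E.

(* Main.v *)
(** For [G] the corridor of [g1] and [g2], the event [xi_s \in a G] shrinks as
    [s] grows, because [g1] and [g2] are non-decreasing.  As [Lambda t >=
    lambda t] almost surely, the event [eta_t \in y_t G] is contained in the one
    at the deterministic time [lambda t]; by independence its probability is at
    least [V_t (c * lambda t)] times that of the event at time [c * lambda t],
    and [V_t (c * lambda t)] is bounded below while [lambda t * zeta (y t)] tends
    to infinity.  It remains to compare with the asymptotics of [xi] at the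
    times [c * tlambda t], [c] near 1; these follow from the hypothesis on [xi]
    applied to [s |-> y (tlambda^-1 (s / c))], which is [o(B s)] by the growth
    condition on [B]. *)

Require Import Defs.
From HB Require Import structures.
From mathcomp Require Import all_boot all_order all_algebra.
From mathcomp Require Import all_classical all_reals all_analysis ess_sup_inf.
From mathcomp Require Import ring lra.

Set Implicit Arguments.
Unset Strict Implicit.
Unset Printing Implicit Defensive.

Import Order.TTheory GRing.Theory Num.Theory.
Import numFieldNormedType.Exports.

Local Open Scope classical_set_scope.
Local Open Scope ring_scope.

(** * Corridor conditions along a single path *)

Definition in_tube (R : realType) (g1 g2 f : R -> R) (s a : R) : Prop :=
  forall u : R, 0 <= u <= 1 -> - (a * g1 u) <= f (s * u) <= a * g2 u.

Lemma skorohod01_rescale (R : realType) (f : R -> R) (s : R) : 0 < s ->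
  cadlag_halfline f -> skorohod01 (fun u => f (s * u)).
Proof.
move=> s0 [fr fl]; split=> u /andP[u0 u1].
- have su0 : 0 <= s * u by rewrite mulr_ge0// ltW.
  have /cvgrPdist_lt fsu := fr _ su0.
  apply/cvgrPdist_lt => e /fsu [r /= r0 Hr].
  exists (r / s) => /=; first by rewrite divr_gt0.
  move=> x /= xu ux; apply: Hr => /=; last by rewrite ltr_pM2l.
  by rewrite -mulrBr normrM gtr0_norm// mulrC -ltr_pdivlMr.
- have su0 : 0 < s * u by rewrite mulr_gt0.
  have /cvg_ex[l /cvgrPdist_lt fsu] := fl _ su0.
  apply/cvg_ex; exists l; apply/cvgrPdist_lt => e /fsu [r /= r0 Hr].
  exists (r / s) => /=; first by rewrite divr_gt0.
  move=> x /= xu ux; apply: Hr => /=; last by rewrite ltr_pM2l.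
  by rewrite -mulrBr normrM gtr0_norm// mulrC -ltr_pdivlMr.
Qed.

Lemma skorohod01_scale (R : realType) (f : R -> R) (a : R) :
  skorohod01 f -> skorohod01 (fun u => a * f u).
Proof.
move=> [fr fl]; split=> u hu; first by apply: cvgMl_tmp; exact: fr.
have /cvg_ex[l fu] := fl _ hu.
by apply/cvg_ex; exists (a * l); exact: cvgMl_tmp.
Qed.

(** For a cadlag path started at 0, regularity and the value at 0 are automatic, so only the
    two-sided bound remains of membership in a dilated corridor. *)
Lemma dilate_corridorP (R : realType) (g1 g2 f : R -> R) (s a : R) :
  0 < s -> 0 < a -> cadlag_halfline f -> f 0 = 0 ->
  dilate a (corridor g1 g2) (fun u => f (s * u)) <-> in_tube g1 g2 f s a.
Proof.
move=> s0 a0 fcad f0; split=> [[g [_ [_ gb]] gE] u u01|ft].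
  rewrite -[f (s * u)]/((fun u => f (s * u)) u) -gE -mulrN.
  by rewrite !ler_pM2l// gb.
exists (fun u => a^-1 * f (s * u)); last first.
  by apply/funext => u; rewrite mulrA divff ?mul1r// gt_eqF.
split; first by apply: skorohod01_scale; exact: skorohod01_rescale.
split; first by rewrite mulr0 f0 mulr0.
by move=> u /ft; rewrite ler_pdivlMl// ler_pdivrMl// mulrN.
Qed.

(** The time [s * u] equals [s' * v] with [v = s / s' * u <= u], and monotone boundaries are no
    wider at [v] than at [u]. *)
Lemma in_tube_le (R : realType) (g1 g2 f : R -> R) (s s' a : R) :
  corridor_boundary g1 -> corridor_boundary g2 -> 0 <= a ->
  0 < s <= s' -> in_tube g1 g2 f s' a -> in_tube g1 g2 f s a.
Proof.
move=> [_ _ m1] [_ _ m2] a0 /andP[s0 ss'] ft u /andP[u0 u1].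
have s'0 : 0 < s' by exact: lt_le_trans ss'.
have r0 : 0 <= s / s' by rewrite divr_ge0// ltW.
have r1 : s / s' <= 1 by rewrite ler_pdivrMr// mul1r.
have v0 : 0 <= s / s' * u by rewrite mulr_ge0.
have vu : s / s' * u <= u by rewrite ler_piMl.
have v1 : s / s' * u <= 1 by exact: le_trans u1.
have /ft : 0 <= s / s' * u <= 1 by rewrite v0.
rewrite mulrA mulrCA divff ?gt_eqF// mulr1 => /andP[h1 h2].
apply/andP; split.
  by apply: le_trans h1; rewrite lerN2 ler_wpM2l// m1// in_itv/= ?u0 ?v0.
by apply: (le_trans h2); rewrite ler_wpM2l// m2// in_itv/= ?u0 ?v0.
Qed.

(** If [h u > 0], right continuity keeps [h] positive on an interval to the right of [u], which
    contains a rational below 1. *)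
Lemma right_limit_le0 (R : realType) (h : R -> R) (u : R) : 0 <= u < 1 ->
  h x @[x --> u^'+] --> h u ->
  (forall q : rat, 0 <= (ratr q : R) <= 1 -> h (ratr q) <= 0) -> h u <= 0.
Proof.
move=> /andP[u0 u1] hu hq; rewrite leNgt; apply/negP => hu0.
have [r /= r0 Hr] := cvgr_gt _ hu _ hu0.
have /rat_in_itvoo[q] : u < Num.min 1 (u + r).
  by rewrite lt_min u1 ltrDl.
rewrite in_itv/= lt_min => /and3P[uq q1 qr].
have : 0 < h (ratr q).
  by apply: Hr => //=; rewrite distrC gtr0_norm ?subr_gt0// ltrBlDl.
by rewrite ltNge hq// (ltW q1) andbT (le_trans u0 (ltW uq)).
Qed.

Lemma corridor_boundary_right_cvg (R : realType) (g : R -> R) (u : R) :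
  corridor_boundary g -> 0 <= u < 1 -> g x @[x --> u^'+] --> g u.
Proof.
move=> [_ /continuous_within_itvP gc _] /andP[u0 u1].
have [gi g0 _] := gc ltr01.
move: u0; rewrite le_eqVlt => /predU1P[<-//|u0].
by apply: cvg_at_right_filter; apply: gi; rewrite in_itv/= u0.
Qed.

Lemma in_tube_rat (R : realType) (g1 g2 f : R -> R) (s a : R) :
  corridor_boundary g1 -> corridor_boundary g2 -> cadlag_halfline f -> 0 < s ->
  in_tube g1 g2 f s a <->
  forall q : rat, 0 <= (ratr q : R) <= 1 ->
    - (a * g1 (ratr q)) <= f (s * ratr q) <= a * g2 (ratr q).
Proof.
move=> g1b g2b fcad s0; split=> [ft q|fq u /andP[u0]]; first exact: ft.
(* Right limits are of no use at the endpoint 1, but 1 is itself rational. *)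
rewrite le_eqVlt => /predU1P[->|u1].
  by have := fq 1%Q; rewrite rmorph1 ler01 lexx; exact.
have u01 : 0 <= u < 1 by rewrite u0.
have fc := (skorohod01_rescale s0 fcad).1 _ u01.
have c1 := corridor_boundary_right_cvg g1b u01.
have c2 := corridor_boundary_right_cvg g2b u01.
rewrite -subr_le0 -[in X in _ && X]subr_le0; apply/andP; split.
  apply: (right_limit_le0 (h := fun x => - (a * g1 x) - f (s * x)) u01).
    by apply: cvgB => //; apply: cvgN; exact: cvgMl_tmp.
  by move=> q /fq /andP[+ _]; rewrite subr_le0.
apply: (right_limit_le0 (h := fun x => f (s * x) - a * g2 x) u01).
  by apply: cvgB => //; exact: cvgMl_tmp.
by move=> q /fq /andP[_]; rewrite subr_le0.
Qed.

(* Restricting to rational times makes the event measurable; right continuity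
   makes it almost surely equal to the one over all times. *)
Definition tube_event (T : Type) (R : realType) (X : R -> T -> R)
    (g1 g2 : R -> R) (s a : R) : set T :=
  [set w | forall q : rat, 0 <= (ratr q : R) <= 1 ->
    - (a * g1 (ratr q)) <= X (s * ratr q) w <= a * g2 (ratr q)].

(** * Measurability of corridor events *)

Lemma process_sigma_preimage d (T : measurableType d) (R : realType)
    (X : R -> T -> R) (t : R) (A : set R) :
  0 <= t -> measurable A -> process_sigma X (X t @^-1` A).
Proof.
by move=> t0 mA; apply: sub_sigma_algebra; exists t; split=> //; exists A.
Qed.

Lemma process_sigma_measurable d (T : measurableType d) (R : realType)
    (X : R -> T -> R) (A : set T) :
  (forall t, measurable_fun setT (X t)) -> process_sigma X A -> measurable A.
Proof.
move=> mX; apply: smallest_sub; first exact: sigma_algebra_measurable.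
by move=> _ [t [_ [B [mB ->]]]]; rewrite -[_ @^-1` _]setTI; exact: mX.
Qed.

Lemma process_sigma_RV d (T : measurableType d) (R : realType)
    (P : probability T R) (X : R -> {RV P >-> R}) (A : set T) :
  process_sigma X A -> measurable A.
Proof. by apply: process_sigma_measurable => t; exact: measurable_funPT. Qed.

(** Independence is stated for events of the sigma-algebra generated by the process, so
    measurability alone would not suffice. *)
Lemma process_sigma_tube_event d (T : measurableType d) (R : realType)
    (X : R -> T -> R) (g1 g2 : R -> R) (s a : R) :
  0 <= s -> process_sigma X (tube_event X g1 g2 s a).
Proof.
move=> s0; set E := fun q : rat => [set w | 0 <= (ratr q : R) <= 1 ->
    - (a * g1 (ratr q)) <= X (s * ratr q) w <= a * g2 (ratr q)].
(* The rationals are enumerated by [unpickle]; integers that code no rational contribute the whole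
   space. *)
have -> : tube_event X g1 g2 s a =
    \bigcap_n (if unpickle n is Some q then E q else setT).
  apply/seteqP; split=> w /= Ew; first by move=> n _; case: unpickle.
  by move=> q; have := Ew (pickle q) I; rewrite pickleK.
apply: (@bigcapT_measurable _ (g_sigma_algebraType _)) => n.
case: unpickle => [q|]; last exact: measurableT.
have [/andP[q0 q1]|qN] := boolP (0 <= (ratr q : R) <= 1); last first.
  rewrite (_ : E q = setT); first exact: measurableT.
  by apply/seteqP; split=> // w _; rewrite /E/= (negbTE qN).
rewrite (_ : E q = X (s * ratr q) @^-1`
    `[- (a * g1 (ratr q)), a * g2 (ratr q)]%classic).
  by apply: process_sigma_preimage; [exact: mulr_ge0|exact: measurable_itv].
apply/seteqP; split=> w; rewrite /E/= in_itv/= q0 q1; first exact.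
by move=> h _.
Qed.

(** * Outer probabilities of corridor events *)

(** [A] is covered by [B] and a measurable null set, a measurable union whose outer measure is
    [P B]. *)
Lemma Pr_le_ae d (T : measurableType d) (R : realType) (P : probability T R)
    (A B : set T) : measurable B -> {ae P, forall w, A w -> B w} ->
  (Pr P A <= P B)%E.
Proof.
move=> mB [N [mN N0 AB]].
have /(le_mu_ext P)/le_trans : A `<=` B `|` N.
  by move=> w Aw; have [Bw|Bw] := pselect (B w); [left|right; apply: AB => /(_ Aw)].
apply; rewrite measurable_mu_extE; last exact: measurableU.
by rewrite measureU0.
Qed.

(** Removing a null set from [A] leaves a measurable subset of [B] with the same probability as
    [A]. *)
Lemma Pr_ge_ae d (T : measurableType d) (R : realType) (P : probability T R)
    (A B : set T) : measurable A -> {ae P, forall w, A w -> B w} ->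
  (P A <= Pr P B)%E.
Proof.
move=> mA [N [mN N0 AB]].
have : A `\` N `<=` B.
  by move=> w [Aw Nw]; apply: contrapT => Bw; apply: Nw; apply: AB => /(_ Aw).
move=> /(le_mu_ext P); apply: le_trans.
have mAN := measurableD mA mN.
rewrite measurable_mu_extE// -(measureU0 mAN mN N0) le_measure ?inE//.
  exact: measurableU.
by move=> w Aw; have [Nw|Nw] := pselect (N w); [right|left].
Qed.

Lemma Pr_tube d (T : measurableType d) (R : realType) (P : probability T R)
    (xi : R -> {RV P >-> R}) (g1 g2 : R -> R) (s a : R) :
  {ae P, forall w, cadlag_halfline (fun t => xi t w) /\ xi 0 w = 0} ->
  corridor_boundary g1 -> corridor_boundary g2 -> 0 < s -> 0 < a ->
  Pr P [set w | dilate a (corridor g1 g2) (fun u => xi (s * u) w)] =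
  P (tube_event xi g1 g2 s a).
Proof.
move=> paths g1b g2b s0 a0.
have mE : measurable (tube_event xi g1 g2 s a).
  by apply: (@process_sigma_RV _ _ _ P xi); apply: process_sigma_tube_event; exact: ltW.
apply/eqP; rewrite eq_le; apply/andP; split.
  apply: Pr_le_ae => //; apply: filterS paths => w [cad w0] /=.
  by move=> /(dilate_corridorP _ _ s0 a0 cad w0)/in_tube_rat; exact.
apply: Pr_ge_ae => //; apply: filterS paths => w [cad w0] wE /=.
by apply/(dilate_corridorP _ _ s0 a0 cad w0)/in_tube_rat.
Qed.

(** By [in_tube_le], the condition at the longer random horizon [L w] implies the one at [s]. *)
Lemma Pr_subordinated_le d (T : measurableType d) (R : realType)
    (P : probability T R) (xi : R -> {RV P >-> R}) (L : T -> R)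
    (g1 g2 : R -> R) (s a : R) :
  {ae P, forall w, cadlag_halfline (fun t => xi t w) /\ xi 0 w = 0} ->
  corridor_boundary g1 -> corridor_boundary g2 -> 0 < s -> 0 < a ->
  {ae P, forall w, s <= L w} ->
  (Pr P [set w | dilate a (corridor g1 g2) (fun u => xi (L w * u)%R w)] <=
   Pr P [set w | dilate a (corridor g1 g2) (fun u => xi (s * u)%R w)])%E.
Proof.
move=> paths g1b g2b s0 a0 sL; rewrite (Pr_tube paths g1b g2b s0 a0).
apply: Pr_le_ae.
  by apply: (@process_sigma_RV _ _ _ P xi); apply: process_sigma_tube_event; exact: ltW.
apply: filterS2 paths sL => w [cad w0] sL /=.
have L0 : 0 < L w by exact: lt_le_trans sL.
move=> /(dilate_corridorP _ _ L0 a0 cad w0) wL.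
apply/(@in_tube_rat _ _ _ (fun t => xi t w)) => //.
by apply: in_tube_le wL => //; [exact: ltW|rewrite s0].
Qed.

(** Where [Lambda t < r <= s], the condition at horizon [s] implies the one at [Lambda t]; by
    independence the intersection of the two events has the product probability. *)
Lemma Pr_subordinated_ge d (T : measurableType d) (R : realType)
    (P : probability T R) (xi Lambda : R -> {RV P >-> R})
    (g1 g2 : R -> R) (t r s a : R) :
  independent_processes P xi Lambda ->
  {ae P, forall w, cadlag_halfline (fun t => xi t w) /\ xi 0 w = 0} ->
  corridor_boundary g1 -> corridor_boundary g2 -> 0 <= t -> 0 < s -> r <= s -> 0 < a ->
  {ae P, forall w, 0 < Lambda t w} ->
  (P [set w | Lambda t w < r]%R *
     Pr P [set w | dilate a (corridor g1 g2) (fun u => xi (s * u)%R w)] <=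
   Pr P [set w | dilate a (corridor g1 g2) (fun u => xi (Lambda t w * u)%R w)])%E.
Proof.
move=> indep paths g1b g2b t0 s0 rs a0 L0.
rewrite (Pr_tube paths g1b g2b s0 a0) muleC.
have xiE : process_sigma xi (tube_event xi g1 g2 s a).
  by apply: process_sigma_tube_event; exact: ltW.
have LE : process_sigma Lambda [set w | Lambda t w < r].
  rewrite (_ : [set w | _] = Lambda t @^-1` `]-oo, r[%classic).
    exact: process_sigma_preimage.
  by apply/seteqP; split=> w /=; rewrite in_itv.
rewrite -indep//; apply: Pr_ge_ae.
  by apply: measurableI; [exact: process_sigma_RV xiE|exact: process_sigma_RV LE].
apply: filterS2 paths L0 => w [cad w0] L0 [/= wE Lr].
apply/(dilate_corridorP _ _ L0 a0 cad w0).
apply: (@in_tube_le _ _ _ _ _ s) => //; first exact: ltW.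
  by rewrite L0 ltW// (lt_le_trans Lr).
exact/in_tube_rat.
Qed.

(** * Eventual bounds and logarithmic asymptotics *)

Lemma limf_esup_bounded (R : realType) (f : R -> \bar R) (F : set_system R) :
  Filter F ->
  (limf_esup f F < +oo)%E ->
  exists2 M : R, 0 < M & \forall x \near F, (f x <= M%:E)%E.
Proof.
move=> FF; rewrite limf_esupE => /ereal_inf_lt[_ [V FV <-]] supV.
have [M M0 VM] : exists2 M : R, 0 < M & (ereal_sup (f @` V) <= M%:E)%E.
  case: ereal_sup supV => [r _|//|_]; last by exists 1 => //; rewrite leNye.
  by exists (Num.max 1 r); rewrite ?lt_max ?ltr01// lee_fin le_max lexx orbT.
exists M => //; apply: filterS FV => x Vx.
by apply: le_trans VM; apply: ereal_sup_ubound; exists x.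
Qed.

Lemma limf_einf_gt0 (R : realType) (f : R -> \bar R) (F : set_system R) :
  Filter F ->
  (0 < limf_einf f F)%E ->
  exists2 v : R, 0 < v & \forall x \near F, (v%:E <= f x)%E.
Proof.
move=> FF; rewrite limf_einfE => /ereal_sup_gt[_ [V FV <-]] infV.
have [v v0 Vv] : exists2 v : R, 0 < v & (v%:E <= ereal_inf (f @` V))%E.
  case: ereal_inf infV => [r r0|_|//]; first by exists r.
  by exists 1 => //; rewrite leey.
exists v => //; apply: filterS FV => x Vx.
by apply: (le_trans Vv); apply: ereal_inf_lbound; exists x.
Qed.

(** The epsilon form lets upper and lower bounds be proved separately. Taking only [e < 1] loses
    nothing, as a smaller [e] gives a stronger estimate. *)
Lemma log_asymptoticsP (R : realType) (p : R -> \bar R) (b : R -> R) :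
  (\forall t \near +oo, 0 < b t) ->
  log_asymptotics p (fun t => - b t) <->
  forall e : R, 0 < e < 1 -> \forall t \near +oo,
    ((- (b t * (1 + e)))%:E <= lne (p t) <= (- (b t * (1 - e)))%:E)%E.
Proof.
move=> b0; split=> [[r [r0 pr]] e /andP[e0 _]|H].
  have /cvgrPdist_lt /(_ _ e0) := r0.
  apply: filterS3 b0 pr => t bt ->; rewrite sub0r normrN ltr_norml => /andP[h1 h2].
  rewrite !lee_fin mulNr !lerN2 !ler_pM2l// lerD2l (ltW h2) andTb.
  by rewrite lerD2l ltW.
have h : 0 < (2^-1 : R) < 1 by rewrite invr_gt0 ltr0n invf_lt1 ?ltr1n.
(* This error term solves [lne (p t) = - b t * (1 + error)]; for large [t] the bounds with [e = 1/2]
   make [lne (p t)] finite, so [fine] loses nothing. *)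
exists (fun t => - fine (lne (p t)) / b t - 1); split; last first.
  apply: filterS2 b0 (H _ h) => t bt.
  case: lne => [l|/andP[_]|/andP[+ _]] /=; rewrite ?leye_eq ?leeNy_eq// => _.
  by congr EFin; field; rewrite gt_eqF.
apply/cvgrPdist_le => e e0.
have he : 0 < Num.min e 2^-1 < 1.
  by rewrite lt_min e0 gt_min !(andP h).1 (andP h).2 orbT.
apply: filterS2 b0 (H _ he) => t bt.
have em : Num.min e 2^-1 <= e by rewrite ge_min lexx.
move: (Num.min _ _) em {he} => m me.
case: lne => [l|/andP[_]|/andP[+ _]]; rewrite ?leye_eq ?leeNy_eq//.
rewrite !lee_fin/= sub0r normrN => /andP[h1 h2].
apply: le_trans me; rewrite ler_norml lerBrDr lerBlDr.
by rewrite ler_pdivlMr// ler_pdivrMr//; apply/andP; split; lra.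
Qed.

(** * Change of time scale *)

Lemma increasing_inverse (R : realType) (f : R -> R) :
  {within `[0, +oo[, continuous f} ->
  {in `[0, +oo[ &, {homo f : s t / s < t}} ->
  f t @[t --> +oo] --> +oo ->
  exists g : R -> R, [/\ forall s : R, 0 < g s,
    forall t : R, 0 < t -> g (f t) = t,
    \forall s \near +oo, f (g s) = s &
    g s @[s --> +oo] --> +oo].
Proof.
move=> fc fi /cvgryPge fy.
have inj s t : 0 < s -> 0 < t -> f s = f t -> s = t.
  move=> s0 t0 st; apply/eqP; case: ltgtP => // lt_st.
    by have := fi s t; rewrite !in_itv/= !andbT !ltW// st ltxx => /(_ isT isT lt_st).
  by have := fi t s; rewrite !in_itv/= !andbT !ltW// st ltxx => /(_ isT isT lt_st).
(* The default value 1 outside the range of [f] keeps the inverse positive everywhere. *)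
have : forall s, exists t, 0 < t /\ ((exists2 u, 0 < u & f u = s) -> f t = s).
  move=> s; have [[u u0 fu]|nu] := pselect (exists2 u, 0 < u & f u = s).
    by exists u.
  by exists 1.
move=> /choice[g gP]; exists g.
have fgK : \forall s \near +oo, f (g s) = s.
  near=> s; apply: (gP s).2.
  have [N [_ HN]] := fy s.
  pose b := Num.max 1 N + 1.
  have b0 : 0 < b by rewrite /b addr_gt0// lt_max ltr01.
  have sb : s <= f b by apply: HN; rewrite /b ltr_pwDr// le_max lexx orbT.
  have f0s : f 0 < s by near: s; exact: nbhs_pinfty_gt (num_real _).
  have fc' : {within `[0, b], continuous f}.
    by apply: continuous_subspaceW fc => x /=; rewrite !in_itv/= => /andP[->].
  have f0b : f 0 <= f b by rewrite ltW// (lt_le_trans f0s).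
  have [|c] := IVT (ltW b0) fc' (v := s).
    by rewrite (min_idPl f0b) (max_idPr f0b) (ltW f0s).
  (* The preimage cannot be 0, because [f 0 < s]. *)
  rewrite in_itv/= => /andP[c0 _] fcs; exists c => //.
  rewrite lt_neqAle c0 andbT; apply/negP => /eqP c00.
  by move: f0s; rewrite c00 fcs ltxx.
split => //.
- by move=> s; have [] := gP s.
- by move=> t t0; apply: inj => //; [have [] := gP (f t)|apply: (gP _).2; exists t].
- apply/cvgryPge => A; near=> s.
  have fg : f (g s) = s by near: s.
  rewrite leNgt; apply/negP => gA.
  have g0 := (gP s).1.
  have A0 : 0 < A by exact: lt_trans gA.
  have := fi (g s) A; rewrite !in_itv/= !andbT !ltW// fg => /(_ isT isT gA).
  by apply/negP; rewrite -leNgt; near: s; exact: nbhs_pinfty_ge (num_real _).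
Unshelve. all: by end_near. Qed.

(** The level [y (g (c^-1 * s))], with [g] inverse to [f], becomes [y t] at [s = c * f t]. Its
    growth conditions are checked in the variable [t] and carried over by [t = g (c^-1 * s)]. *)
Lemma log_asymptotics_rescale (R : realType) (p : R -> R -> \bar R)
    (B zeta f y : R -> R) (h c : R) :
  (forall t : R, 0 < t -> 0 < B t) ->
  (forall c : R, 0 < c ->
    (limf_esup (fun t : R => (B (c * t) / B t)%:E) (pinfty_nbhs R) < +oo)%E) ->
  (forall y : R -> R, (forall t : R, 0 < t -> 0 < y t) ->
    y t @[t --> +oo] --> +oo ->
    y t / B t @[t --> +oo] --> 0 ->
    t * zeta (y t) @[t --> +oo] --> +oo ->
    log_asymptotics (fun t => p t (y t)) (fun t => - (t * h * zeta (y t)))) ->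
  {within `[0, +oo[, continuous f} ->
  {in `[0, +oo[ &, {homo f : s t / s < t}} ->
  f t @[t --> +oo] --> +oo ->
  (forall t : R, 0 < t -> 0 < y t) ->
  y t @[t --> +oo] --> +oo ->
  y t / B (f t) @[t --> +oo] --> 0 ->
  f t * zeta (y t) @[t --> +oo] --> +oo ->
  0 < c ->
  log_asymptotics (fun t => p (c * f t) (y t))
                  (fun t => - (c * f t * h * zeta (y t))).
Proof.
move=> B0 Bratio pasym fc fi foo y0 yoo yB yzeta c0.
have [g [g0 gK fgK goo]] := increasing_inverse fc fi foo.
have scale_oo (k : R) : 0 < k -> k * s @[s --> +oo%R] --> +oo%R.
  move=> k0; apply/cvgryPge => A; near=> s.
  by rewrite -ler_pdivrMl//; near: s; exact: nbhs_pinfty_ge (num_real _).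
have ic0 : 0 < c^-1 by rewrite invr_gt0.
have gcoo : g (c^-1 * s) @[s --> +oo] --> +oo := cvg_comp _ _ (scale_oo _ ic0) goo.
have cfoo : c * f t @[t --> +oo] --> +oo := cvg_comp _ _ foo (scale_oo _ c0).
have fgc : \forall s \near +oo, c * f (g (c^-1 * s)) = s.
  have : \forall s \near +oo, f (g (c^-1 * s)) = c^-1 * s by exact: (scale_oo _ ic0 _ fgK).
  by apply: filterS => s ->; rewrite mulVKf// gt_eqF.
have [||||e [e0 pe]] := pasym (fun s => y (g (c^-1 * s))).
- by move=> t _; exact: y0.
- exact: (cvg_comp _ _ gcoo yoo).
- have yBc : y t / B (c * f t) @[t --> +oo] --> 0.
    (* The growth condition with factor [c^-1], taken at [c * f t], bounds
       [B (f t) / B (c * f t)]. *)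
    have [M M0 BM] := limf_esup_bounded _ (Bratio _ ic0).
    apply/cvgrPdist_lt => eps eps0.
    have epsM : 0 < eps / M by rewrite divr_gt0.
    near=> t; rewrite sub0r normrN.
    have t0 : 0 < t by near: t; exact: nbhs_pinfty_gt (num_real _).
    have ft0 : 0 < f t by near: t; exact: (cvgryPgt _).1 foo 0.
    have cft0 : 0 < c * f t by rewrite mulr_gt0.
    have h1 : `|y t / B (f t)| < eps / M.
      rewrite -normrN -sub0r; near: t.
      by have /cvgrPdist_lt := yB; exact.
    have h2 : ((B (c^-1 * (c * f t)) / B (c * f t))%:E <= M%:E)%E.
      by near: t; exact: (cfoo _ BM).
    move: h1 h2; rewrite mulKf ?gt_eqF// lee_fin.
    rewrite !gtr0_norm ?divr_gt0 ?B0 ?y0// => h1 h2.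
    have -> : y t / B (c * f t) = y t / B (f t) * (B (f t) / B (c * f t)).
      by field; rewrite !gt_eqF ?B0.
    apply: (@le_lt_trans _ _ (y t / B (f t) * M)).
      by rewrite ler_pM2l// divr_gt0 ?B0 ?y0.
    by rewrite -ltr_pdivlMr.
  have := cvg_comp _ _ gcoo yBc; apply: cvg_trans; apply: near_eq_cvg.
  by apply: filterS fgc => s /= ->.
- have yzc : c * f t * zeta (y t) @[t --> +oo] --> +oo.
    have := cvg_comp _ _ yzeta (scale_oo _ c0); apply: cvg_trans.
    by apply: near_eq_cvg; near=> t; rewrite /= mulrA.
  have := cvg_comp _ _ gcoo yzc; apply: cvg_trans; apply: near_eq_cvg.
  by apply: filterS fgc => s /= ->.
exists (fun t => e (c * f t)); split; first exact: (cvg_comp _ _ cfoo e0).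
near=> t.
have t0 : 0 < t by near: t; exact: nbhs_pinfty_gt (num_real _).
have : lne (p (c * f t) (y (g (c^-1 * (c * f t))))) =
  (- (c * f t * h * zeta (y (g (c^-1 * (c * f t))))) * (1 + e (c * f t)))%:E.
  by near: t; exact: (cfoo _ pe).
by rewrite mulKf ?gt_eqF// gK.
Unshelve. all: by end_near. Qed.

(** * Comparison with deterministic times *)

Lemma ratio_cvg1_bounds (R : realType) (f g : R -> R) :
  (\forall t \near +oo, 0 < f t) -> f t / g t @[t --> +oo] --> (1 : R) ->
  forall d : R, 0 < d < 1 -> \forall t \near +oo,
    [/\ 0 < g t, (1 - d) * g t <= f t & f t <= (1 + d) * g t].
Proof.
move=> f0 fg d /andP[d0 d1]; have /cvgrPdist_lt /(_ _ d0) := fg.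
apply: filterS2 f0 => t ft0 ltf.
have gt0 : 0 < g t.
  rewrite ltNge; apply/negP => gt0.
  have : f t / g t <= 0 by rewrite pmulr_rle0// invr_le0.
  by move: ltf; rewrite ltr_norml => /andP[h1 h2]; lra.
move: ltf; rewrite ltr_norml => /andP[h1 h2]; split=> //.
  by rewrite -ler_pdivlMr//; lra.
by rewrite -ler_pdivrMr//; lra.
Qed.

(** Here [p s a] stands for the probability at deterministic time [s] and level [a], [q] for the
    subordinated one, and [k] for the rate. The asymptotics of [p] are known along multiples of [f],
    so [q] is compared with [p] at [(1 - d) * f t] and [(1 + d)^2 * f t]. *)
Lemma log_asymptotics_sandwich (R : realType) (p : R -> R -> \bar R)
    (q : R -> \bar R) (lambda f y k : R -> R) :
  (forall t, 0 <= q t)%E -> (forall s a, 0 <= p s a)%E ->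
  (\forall t \near +oo, 0 < k t) ->
  lambda t / f t @[t --> +oo] --> (1 : R) ->
  lambda t @[t --> +oo] --> +oo ->
  lambda t * k t @[t --> +oo] --> +oo ->
  (forall c : R, 0 < c -> log_asymptotics (fun t => p (c * f t) (y t))
                                      (fun t => - (c * f t * k t))) ->
  (\forall t \near +oo, forall s : R, (0 < s <= lambda t)%R -> (q t <= p s (y t))%E) ->
  (forall c : R, 1 < c -> exists2 v : R, 0 < v & \forall t \near +oo,
    forall s : R, (c * lambda t <= s)%R -> (v%:E * p s (y t) <= q t)%E) ->
  log_asymptotics q (fun t => - (lambda t * k t)).
Proof.
move=> q0 p0 k0 lf loo lkoo pasym qle qge.
have l0 : \forall t \near +oo, 0 < lambda t by exact: (cvgryPgt _).1 loo 0.
have lfd := ratio_cvg1_bounds l0 lf.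
have f0 : \forall t \near +oo, 0 < f t.
  by have := lfd 2^-1; rewrite invr_gt0 ltr0n invf_lt1 ?ltr1n// => /(_ isT);
     apply: filterS => t [].
have cfk0 c : 0 < c -> \forall t \near +oo, 0 < c * f t * k t.
  by move=> c0; apply: filterS2 f0 k0 => t ft kt; rewrite !mulr_gt0.
apply/log_asymptoticsP; first by apply: filterS2 l0 k0 => t lt kt; rewrite mulr_gt0.
move=> e /andP[e0 e1].
(* With 16 = 1 + 15 and d <= 1/16: (1 + d)^3 (1 + 2 d) <= 1 + 15 d, and the
   remaining d absorbs [ln v]. *)
pose d := e / 16.
have d0 : 0 < d by rewrite divr_gt0.
have d1 : d < 1 by rewrite /d; lra.
have d01 : 0 < d < 1 by rewrite d0.
have upper : \forall t \near +oo, (lne (q t) <= (- (lambda t * k t * (1 - e)))%:E)%E.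
  have c0 : 0 < 1 - d by rewrite subr_gt0.
  have /(log_asymptoticsP _ (cfk0 _ c0)) /(_ d d01) pd := pasym _ c0.
  near=> t.
  have [ft0 fl lf'] : [/\ 0 < f t, (1 - d) * f t <= lambda t
      & lambda t <= (1 + d) * f t] by near: t; exact: lfd.
  have kt0 : 0 < k t by near: t.
  have qp : (q t <= p ((1 - d) * f t)%R (y t))%E.
    move: ((1 - d) * f t) (mulr_gt0 c0 ft0) fl => s s0 sl.
    suff : forall s : R, (0 < s <= lambda t)%R -> (q t <= p s (y t))%E.
      by apply; rewrite s0.
    by near: t.
  have /andP[_ pl] : ((- ((1 - d) * f t * k t * (1 + d)))%:E
      <= lne (p ((1 - d) * f t)%R (y t))
      <= (- ((1 - d) * f t * k t * (1 - d)))%:E)%E by near: t.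
  apply: (@le_trans _ _ (lne (p ((1 - d) * f t)%R (y t)))).
    by rewrite lee_lne// in_itv/= ?p0 ?q0 leey.
  apply: (le_trans pl); rewrite lee_fin lerN2.
  have fk0 : 0 < f t * k t by rewrite mulr_gt0.
  apply: (@le_trans _ _ ((1 + d) * f t * k t * (1 - e))).
    by rewrite ler_pM2r ?subr_gt0// ler_pM2r.
  rewrite -!mulrA [k t * _]mulrC [k t * (1 - d)]mulrC !mulrA.
  rewrite ler_pM2r//.
  have -> : e = 16 * d by rewrite /d; field.
  (* The factor [d * (13 + 17 * d)] is [(1 - d)^2 - (1 + d) * (1 - 16 * d)]. *)
  have : 0 <= f t * (d * (13 + 17 * d)) by rewrite mulr_ge0 ?(ltW ft0)//; nra.
  by nra.
have lower : \forall t \near +oo, ((- (lambda t * k t * (1 + e)))%:E <= lne (q t))%E.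
  have c1 : 1 < 1 + d by rewrite ltrDl.
  have [v v0 qv] := qge _ c1.
  (* One factor [1 + d] passes from [lambda] to [f], the other is the constant [c] of the lower
     comparison. *)
  have c0 : 0 < (1 + d) * (1 + d) by rewrite mulr_gt0// addr_gt0.
  have /(log_asymptoticsP _ (cfk0 _ c0)) /(_ d d01) pd := pasym _ c0.
  (* The constant [ln v] is negligible because [lambda t * k t] tends to infinity. *)
  have vk : \forall t \near +oo, - ln v / d <= lambda t * k t.
    exact: (cvgryPge _).1 lkoo _.
  near=> t.
  have [ft0 fl lf'] : [/\ 0 < f t, (1 - d) * f t <= lambda t
      & lambda t <= (1 + d) * f t] by near: t; exact: lfd.
  have kt0 : 0 < k t by near: t.
  have lt0 : 0 < lambda t by near: t.
  have vkt : - ln v <= lambda t * k t * d.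
    by rewrite -ler_pdivrMr//; near: t.
  have /andP[pl _] : ((- ((1 + d) * (1 + d) * f t * k t * (1 + d)))%:E
      <= lne (p ((1 + d) * (1 + d) * f t)%R (y t))
      <= (- ((1 + d) * (1 + d) * f t * k t * (1 - d)))%:E)%E by near: t.
  set s := (1 + d) * (1 + d) * f t in pl.
  have pq : (v%:E * p s (y t) <= q t)%E.
    suff : forall s : R, ((1 + d) * lambda t <= s)%R -> (v%:E * p s (y t) <= q t)%E.
      by apply; rewrite /s -mulrA ler_pM2l// addr_gt0.
    by near: t.
  (* Splitting the logarithm of the product needs positive factors; a zero here would give [-oo]
     against the finite lower bound. *)
  have ps0 : (0 < p s (y t))%E.
    rewrite lt_neqAle p0 andbT; apply/eqP => p00.
    by move: pl; rewrite -p00 le0_lneNy// leeNy_eq.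
  have vp0 : (0 <= v%:E * p s (y t))%E by rewrite mule_ge0// lee_fin ltW.
  have : (lne (v%:E * p s (y t)) <= lne (q t))%E.
    by rewrite lee_lne// in_itv/= ?q0 ?vp0 leey.
  have vI : v%:E \in `]0%E, +oo%E] by rewrite in_itv/= lte_fin v0 leey.
  have pI : p s (y t) \in `]0%E, +oo%E] by rewrite in_itv/= ps0 leey.
  apply: le_trans; rewrite (lneM vI pI) lne_EFin//; apply: le_trans (leeD2l _ pl).
  rewrite -EFinD lee_fin.
  (* This inverts [(1 - d) * f t <= lambda t], since [(1 + 2 * d) * (1 - d) = 1 + d * (1 - 2 * d) >=
     1]. *)
  have fk : f t * k t <= (1 + 2 * d) * (lambda t * k t).
    rewrite mulrA ler_pM2r//.
    have : (1 + 2 * d) * ((1 - d) * f t) <= (1 + 2 * d) * lambda t.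
      by rewrite ler_pM2l// addr_gt0// mulr_gt0.
    apply: le_trans.
    have : 0 <= f t * (d * (1 - 2 * d)).
      by rewrite mulr_ge0 ?(ltW ft0)// mulr_ge0 ?(ltW d0)// /d; lra.
    by nra.
  have lk0 : 0 < lambda t * k t by rewrite mulr_gt0.
  set L := lambda t * k t in fk vkt lk0 *.
  have -> : (1 + d) * (1 + d) * f t * k t * (1 + d) = (1 + d) ^+ 3 * (f t * k t).
    by ring.
  have : (1 + d) ^+ 3 * (f t * k t) <= (1 + d) ^+ 3 * ((1 + 2 * d) * L).
    by rewrite ler_pM2l// exprn_gt0// addr_gt0.
  have : (1 + d) ^+ 3 * (1 + 2 * d) <= 1 + 15 * d.
    have dle (x : R) : 0 < x -> d * x <= 16^-1 * x.
      by move=> x0; rewrite ler_pM2r// /d; lra.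
    have d2 := dle d d0.
    have d3 := dle (d * d) (mulr_gt0 d0 d0).
    have d4 := dle (d * (d * d)) (mulr_gt0 d0 (mulr_gt0 d0 d0)).
    by lra.
  rewrite -(ler_pM2r lk0).
  have -> : e = 16 * d by rewrite /d; field.
  by lra.
by near=> t; apply/andP; split; near: t.
Unshelve. all: by end_near. Qed.

(** * The essential infimum of the clock and the subordinated asymptotics *)

(** [fine] sends both infinities to 0, so a positive [essinf] is the true, finite essential
    infimum. *)
Lemma essinf_le_ae d (T : measurableType d) (R : realType)
    (P : probability T R) (X : T -> R) :
  0 < essinf P X -> {ae P, forall w, essinf P X <= X w}.
Proof.
rewrite /essinf; case E : (ess_inf P (EFin \o X)) => [r| |]/=; rewrite ?ltxx//.
by move=> _; have := ess_inf_le P (EFin \o X); rewrite E.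
Qed.

Theorem theorem1 (R : realType) (d : measure_display) (T : measurableType d)
    (P : probability T R)
    (xi Lambda : R -> {RV P >-> R})
    (B zeta : R -> R) (H : set (R -> R) -> R)
    (indep : independent_processes P xi Lambda)
    (Lambda_paths : {ae P, forall w,
        {within `[0, +oo[, continuous (fun t : R => Lambda t w : R)} /\
        (forall t : R, 0 <= t -> 0 <= Lambda t w) /\ Lambda 0 w = 0})
    (xi_paths : {ae P, forall w,
        cadlag_halfline (fun t => xi t w) /\ xi 0 w = 0})
    (B_pos : forall t : R, 0 < t -> 0 < B t)
    (zeta_pos : forall t : R, 0 < t -> 0 < zeta t)
    (H_pos : forall G : set (R -> R), corridors G -> 0 < H G)
    (B_infty : B t @[t --> +oo%R] --> +oo)
    (zeta_0 : zeta t @[t --> +oo%R] --> 0)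
    (B_ratio : forall c : R, 0 < c ->
        (limf_esup (fun t : R => (B (c * t) / B t)%:E) (pinfty_nbhs R) < +oo)%E)
    (xi_asymp : forall G : set (R -> R), corridors G -> forall y : R -> R,
        (forall t : R, 0 < t -> 0 < y t) ->
        y t @[t --> +oo%R] --> +oo ->
        y t / B t @[t --> +oo%R] --> 0 ->
        t * zeta (y t) @[t --> +oo%R] --> +oo ->
        log_asymptotics
          (fun t => Pr P [set w | dilate (y t) G (fun u => xi (t * u) w)])
          (fun t => - (t * H G * zeta (y t))))
    (G : set (R -> R)) (G_corridor : corridors G)
    (lambda : R -> R) (lambdaE : forall t : R, lambda t = essinf P (Lambda t))
    (tlambda : R -> R)
    (tlambda_cont : {within `[0, +oo[, continuous tlambda})
    (tlambda_incr : {in `[0, +oo[ &, {homo tlambda : s t / s < t}})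
    (lambda_equiv : lambda t / tlambda t @[t --> +oo%R] --> (1 : R))
    (lambda_infty : lambda t @[t --> +oo%R] --> +oo)
    (V_liminf : forall c : R, 1 < c ->
        (0 < limf_einf
               (fun t : R => P [set w | Lambda t w < c * lambda t]%R) (pinfty_nbhs R))%E)
    (y : R -> R) (y_pos : forall t : R, 0 < t -> 0 < y t)
    (y_infty : y t @[t --> +oo%R] --> +oo)
    (y_small : y t / B (tlambda t) @[t --> +oo%R] --> 0)
    (y_zeta : lambda t * zeta (y t) @[t --> +oo%R] --> +oo) :
  log_asymptotics
    (fun t => Pr P [set w | dilate (y t) G (fun u => xi (Lambda t w * u) w)])
    (fun t => - (lambda t * H G * zeta (y t))).
Proof.
have [g1 [g2 [g1b g2b GE]]] := G_corridor.
have l0 : \forall t \near +oo, 0 < lambda t by exact: (cvgryPgt _).1 lambda_infty 0.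
have t0 : \forall t \near +oo, (0 : R) < t by exact: nbhs_pinfty_gt (num_real _).
have k0 : \forall t \near +oo, 0 < H G * zeta (y t).
  by apply: filterS t0 => t t0; rewrite mulr_gt0 ?H_pos ?zeta_pos ?y_pos.
have half : 0 < (2^-1 : R) < 1 by rewrite invr_gt0 ltr0n invf_lt1 ?ltr1n.
(* This bound carries the divergence of [lambda t] and [lambda t * zeta (y t)] over to [tlambda]. *)
have lt2 : \forall t \near +oo, lambda t <= 2 * tlambda t.
  apply: filterS (ratio_cvg1_bounds l0 lambda_equiv half) => t [tl0 _ h].
  by apply: (le_trans h); rewrite ler_pM2r//; lra.
have tl_infty : tlambda t @[t --> +oo%R] --> +oo%R.
  apply/cvgryPge => A; have /cvgryPge /(_ (2 * A)) := lambda_infty.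
  by apply: filterS2 lt2 => t h1 h2; lra.
have tl_zeta : tlambda t * zeta (y t) @[t --> +oo%R] --> +oo%R.
  apply/cvgryPge => A; have /cvgryPge /(_ (2 * A)) := y_zeta.
  apply: filterS3 lt2 t0 => t h1 t0 h2.
  have : lambda t * zeta (y t) <= 2 * tlambda t * zeta (y t).
    by rewrite ler_pM2r ?zeta_pos ?y_pos.
  by lra.
have lk : lambda t * (H G * zeta (y t)) @[t --> +oo%R] --> +oo%R.
  apply/cvgryPge => A; have /cvgryPge /(_ (A / H G)) := y_zeta.
  by apply: filterS => t; rewrite ler_pdivrMr ?H_pos// mulrA mulrAC.
rewrite (_ : (fun t => _ : R) = (fun t => - (lambda t * (H G * zeta (y t))))); last first.
  by apply/funext => t; rewrite mulrA.
pose p s a := Pr P [set w | dilate a G (fun u => xi (s * u) w)].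
have L0 : \forall t \near +oo, {ae P, forall w, lambda t <= Lambda t w}.
  by apply: filterS l0 => t; rewrite lambdaE; exact: essinf_le_ae.
apply: (@log_asymptotics_sandwich _ p _ lambda tlambda y) => //.
- by move=> t; exact: mu_ext_ge0.
- by move=> s a; exact: mu_ext_ge0.
- move=> c c0; rewrite (_ : (fun t => _ : R) =
      (fun t => - (c * tlambda t * H G * zeta (y t)))); last first.
    by apply/funext => t; rewrite !mulrA.
  exact: (log_asymptotics_rescale B_pos B_ratio (xi_asymp G G_corridor)).
- apply: filterS2 t0 L0 => t t0 L0 s /andP[s0 sl].
  rewrite /p GE; apply: Pr_subordinated_le => //; first exact: y_pos.
  by apply: filterS L0 => w; exact: le_trans.
(* The lower bound [v] on the law of [Lambda t] below [c * lambda t] serves every horizon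
   [s >= c * lambda t] at once. *)
- move=> c c1; have [v v0 vV] := limf_einf_gt0 _ (V_liminf _ c1).
  exists v => //.
  apply: filterS3 t0 l0 (filterI L0 vV) => t t0 l0 [{}L0 {}vV] s cs.
  have cl0 : 0 < c * lambda t by rewrite mulr_gt0// (lt_trans ltr01).
  apply: le_trans (lee_wpmul2r _ vV) _; first exact: mu_ext_ge0.
  rewrite /p GE; apply: Pr_subordinated_ge => //.
  + exact: ltW.
  + exact: lt_le_trans cs.
  + exact: y_pos.
  + by apply: filterS L0 => w; exact: lt_le_trans.
Qed.
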